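(* Let $(Z,U)$ and $(Y,S)$ be topological dynamical systems and let $\pi:(Z,U)\to(Y,S)$ be a factor map which is moreover an open map. Then for every $f\in C(Z)$ we have $\alpha(f)\le\beta(f)$.
   Context: A topological dynamical system is a pair $(X,T)$ with $X$ a compact metrizable space and $T:X\to X$ a homeomorphism; $\mathcal{M}_T(X)$ denotes the set of $T$-invariant Borel probability measures on $X$ with the weak* topology. A factor map $\pi:(Z,U)\to(Y,S)$ is a continuous surjection $\pi:Z\to Y$ with $S\circ\pi=\pi\circ U$. $C(Z)$ is the space of real-valued continuous functions on $Z$. For $f\in C(Z)$ and $\nu\in\mathcal{M}_S(Y)$ set $\psi_f(\nu)=\min\{\int f\,d\lambda:\lambda\in\mathcal{M}_U(Z),\ \pi_*\lambda=\nu\}$, and $\alpha(f)=\sup_{\nu\in\mathcal{M}_S(Y)}\psi_f(\nu)$. Let $R_f=\{z\in Z:\lim_{k\to\infty}\frac1k\sum_{j=0}^{k-1}f(U^jz)\text{ exists}\}$ and $\beta(f)=\sup_{y\in\pi(R_f)}\ \inf_{z\in R_f\cap\pi^{-1}\{y\}}\ \lim_{k\to\infty}\frac1k\sum_{j=0}^{k-1}f(U^jz)$. *)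

(* Defs.v *)
From HB Require Import structures.
From mathcomp Require Import all_boot all_order all_algebra.
From mathcomp Require Import all_classical all_reals all_analysis.
Set Implicit Arguments. Unset Strict Implicit. Unset Printing Implicit Defensive.
Import Order.TTheory GRing.Theory Num.Theory.
Import numFieldNormedType.Exports.
Local Open Scope classical_set_scope.
Local Open Scope ring_scope.

Section defs.
Variable R : realType.

Definition Borel (X : pseudoPMetricType R) := g_sigma_algebraType (@open X).

Definition homeomorphism (X : pseudoPMetricType R) (T : X -> X) : Prop :=
  continuous T /\ exists Tinv : X -> X,
    [/\ continuous Tinv, cancel T Tinv & cancel Tinv T].

(* (X,T) is a topological dynamical system: X compact metrizable
   (a Hausdorff pseudometric space = metric space), T a homeomorphism *)
Definition TDS (X : pseudoPMetricType R) (T : X -> X) : Prop :=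
  [/\ compact [set: X], hausdorff_space X & homeomorphism T].

Definition inv_measures (X : pseudoPMetricType R) (T : X -> X)
  : set (probability (Borel X) R) :=
  [set mu | forall A : set (Borel X), measurable A ->
            mu (T @^-1` A) = mu A].

Definition pushforward_eq (Z Y : pseudoPMetricType R) (pi : Z -> Y)
  (lam : probability (Borel Z) R) (nu : probability (Borel Y) R) : Prop :=
  forall B : set (Borel Y), measurable B -> lam (pi @^-1` B) = nu B.

(* psi_f(nu) = min { int f dlam : lam in M_U(Z), pi_* lam = nu }
   (taken as an infimum in the extended reals) *)
Definition psi (Z Y : pseudoPMetricType R) (U : Z -> Z) (pi : Z -> Y)
  (f : Z -> R) (nu : probability (Borel Y) R) : \bar R :=
  ereal_inf [set (\int[lam]_z (f z)%:E)%E |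
     lam in [set lam | inv_measures U lam /\ pushforward_eq pi lam nu]].

Definition alpha (Z Y : pseudoPMetricType R) (U : Z -> Z) (S : Y -> Y)
  (pi : Z -> Y) (f : Z -> R) : \bar R :=
  ereal_sup [set psi U pi f nu | nu in inv_measures S].

Definition birkhoff_avg (Z : pseudoPMetricType R) (U : Z -> Z) (f : Z -> R)
  (z : Z) (k : nat) : R :=
  (k%:R)^-1 * \sum_(j < k) f (iter j U z).

Definition Rf (Z : pseudoPMetricType R) (U : Z -> Z) (f : Z -> R) : set Z :=
  [set z | cvgn (birkhoff_avg U f z)].

Definition beta (Z Y : pseudoPMetricType R) (U : Z -> Z)
  (pi : Z -> Y) (f : Z -> R) : \bar R :=
  ereal_sup [set ereal_inf [set (limn (birkhoff_avg U f z))%:E |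
                            z in Rf U f `&` pi @^-1` [set y]]
            | y in pi @` Rf U f].

End defs.

(* Main.v *)
(** Fix an invariant [nu] on [Y].  For continuous [h] let [p0 h] be the [nu]-integral
of the fibrewise maximum [y |-> max {h z | pi z = y}]; this maximum is Borel
because [pi] is open.  Minimizing over coboundaries, [p h = inf_g p0 (h + g - g o U)]
is sublinear on [C(Z)], and any linear [L <= p] is a [U]-invariant positive
functional extending [w o pi |-> int w dnu].  By Hahn-Banach there is one with
[L f = - p (- f)], and by Riesz it is integration against an invariant lift [lam]
of [nu], so [psi f nu <= int f dlam].  If [c < int f dlam], then for some [g] the
fibrewise minimum [G] of [f - g + g o U] satisfies [int G dnu > c].  If moreover
[beta f < c], then over every point of [pi (Rf)] there is a point whose Birkhoff
averages of [f], hence up to [O(1/k)] those of [G], fall below [c].  Since [lam]-almost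
every point lies in [Rf], the maximal ergodic inequality applied to [c - G o pi]
gives [int G dnu <= c], a contradiction. *)
Require Import Defs.
From HB Require Import structures.
From mathcomp Require Import all_boot all_order all_algebra.
From mathcomp Require Import all_classical all_reals all_analysis.
From mathcomp Require Import measurable_realfun lra ring.
Import Order.TTheory GRing.Theory Num.Theory.
Import numFieldNormedType.Exports.
Local Open Scope classical_set_scope.
Local Open Scope ring_scope.

Set Implicit Arguments.
Unset Strict Implicit.
Unset Printing Implicit Defensive.

(** * Hahn-Banach *)

Definition sublinear (R : realType) (V : lmodType R) (p : V -> R) : Prop :=
  (forall x y, p (x + y) <= p x + p y) /\
  (forall c x, 0 <= c -> p (c *: x) = c * p x).

Lemma sublinear0 (R : realType) (V : lmodType R) (p : V -> R) :
  sublinear p -> p 0 = 0.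
Proof. by move=> [_ pZ]; rewrite -[in LHS](scale0r 0) pZ// mul0r. Qed.

Lemma sublinear_ge (R : realType) (V : lmodType R) (p : V -> R) (x y : V) :
  sublinear p -> p x - p (- y) <= p (x + y).
Proof.
by move=> [pD _]; rewrite lerBlDr; apply: le_trans (pD _ _); rewrite addrK.
Qed.

(** One inequality for positive [c] suffices: used with [c^-1] at [c *: x] it gives the reverse
    one. *)
Lemma sublinear_intro (R : realType) (V : lmodType R) (p : V -> R) :
  p 0 = 0 -> (forall x y, p (x + y) <= p x + p y) ->
  (forall c x, 0 < c -> p (c *: x) <= c * p x) -> sublinear p.
Proof.
move=> p0 pD pZ; split=> // c x; rewrite le_eqVlt => /predU1P[<-|c0].
  by rewrite scale0r mul0r.
apply/eqP; rewrite eq_le pZ//= -ler_pdivlMl//.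
apply: le_trans (pZ _ _ _); last by rewrite invr_gt0.
by rewrite scalerA mulVf ?gt_eqF// scale1r.
Qed.

(** Serves three infima: over a real shift in [sublinear_split], over a chain in [hahn_banach], over
    coboundaries in [p_sublinear]. The minorant [m] makes every infimum a genuine one, and the last
    two conditions let the index vary with the argument. *)
Lemma sublinear_inf (R : realType) (V : lmodType R) (I : Type) (D : set I)
    (q : I -> V -> R) (m : V -> R) :
  D !=set0 -> (forall i x, D i -> m x <= q i x) -> 0 <= m 0 ->
  (exists2 i, D i & q i 0 <= 0) ->
  (forall i j x y, D i -> D j ->
     exists2 k, D k & q k (x + y) <= q i x + q j y) ->
  (forall i c x, D i -> 0 < c -> exists2 k, D k & q k (c *: x) <= c * q i x) ->
  let r x := inf [set q i x | i in D] in
  sublinear r /\ forall i x, D i -> r x <= q i x.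
Proof.
move=> [d Dd] mq m0 [d0 Dd0 q0] qD qZ r.
have rle i x : D i -> r x <= q i x.
  move=> Di; apply: ge_inf; last by exists i.
  by exists (m x) => _ [j Dj <-]; exact: mq.
have le_r c x : (forall i, D i -> c <= q i x) -> c <= r x.
  move=> h; apply: lb_le_inf; first by exists (q d x), d.
  by move=> _ [j Dj <-]; exact: h.
split=> //; apply: sublinear_intro.
- apply/eqP; rewrite eq_le (le_trans (rle _ _ Dd0) q0)/= le_r// => i Di.
  exact: le_trans m0 (mq _ _ Di).
- move=> x y; rewrite -lerBlDr; apply/le_r => i Di.
  rewrite lerBlDr -lerBlDl; apply/le_r => j Dj; rewrite lerBlDl.
  have [k Dk] := qD i j x y Di Dj; exact/le_trans/rle.
- move=> c x c0; rewrite -ler_pdivrMl//; apply/le_r => i Di.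
  rewrite ler_pdivrMl//.
  have [k Dk] := qZ i c x Di c0; exact/le_trans/rle.
Qed.

(** Take [q x] to be the infimum of [p (x + t *: v) - t * p v] over [t >= 0]: [t = 0] gives
    [q <= p], and [t = 1] at [- v] gives the last bound. It both prescribes a value at [v] and shows
    that a minimal sublinear functional is odd. *)
Lemma sublinear_split (R : realType) (V : lmodType R) (p : V -> R) (v : V) :
  sublinear p ->
  exists2 q : V -> R, sublinear q & (forall x, q x <= p x) /\ q (- v) <= - p v.
Proof.
move=> sp; have [pD pZ] := sp; have p0 := sublinear0 sp.
pose f (t : R) x := p (x + t *: v) - t * p v.
have [] := @sublinear_inf _ V R [set t : R | 0 <= t] f (fun x => - p (- x)).
- by exists 0 => /=.
- move=> t x t0; rewrite /f lerBrDr -pZ// addrC [x + _]addrC.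
  exact: sublinear_ge.
- by rewrite oppr0 p0 oppr0.
- by exists 0 => //=; rewrite /f scale0r addr0 p0 mul0r subr0.
- move=> s t x y s0 t0; exists (s + t); first exact: addr_ge0.
  rewrite /f scalerDl addrACA mulrDl opprD [leRHS]addrACA lerD2r; exact: pD.
- move=> t c x t0 c0; exists (c * t); first exact: mulr_ge0 (ltW c0) t0.
  by rewrite /f -scalerA -scalerDr pZ ?(ltW c0)// -mulrA -mulrBr.
move=> sq qf; eexists; first exact: sq; split => [x|].
  by apply: (le_trans (qf 0 x _)) => //=; rewrite /f scale0r addr0 mul0r subr0.
by apply: (le_trans (qf 1 _ _)) => //=; rewrite /f scale1r addNr p0 mul1r sub0r.
Qed.

(* A minimal sublinear functional is linear: [sublinear_split] would otherwise
   produce a smaller one. *)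
Theorem hahn_banach (R : realType) (V : lmodType R) (p : V -> R) (v : V) :
  sublinear p ->
  exists L : V -> R, [/\ forall x y, L (x + y) = L x + L y,
    forall c x, L (c *: x) = c * L x, forall x, L x <= p x & L v = p v].
Proof.
(* Zorn is run below [p1] rather than [p]: a linear [L <= p1] satisfies [- L v = L (- v) <= - p v],
   which forces [L v = p v]. *)
move=> /(sublinear_split v)[p1 sp1 [p1p p1v]].
pose T := {q : V -> R | sublinear q /\ forall x, q x <= p1 x}.
(* The order is reversed, so a maximal element is a minimal functional. *)
pose le (q r : T) := `[< forall x, sval r x <= sval q x >].
have [] := @ZL_preorder T (exist _ p1 (conj sp1 (fun x => lexx _))) le.
- by move=> t; apply/asboolP.
- move=> r s t /asboolP rs /asboolP st; apply/asboolP => x.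
  exact: le_trans (st x) (rs x).
- move=> A tA; have [->|/set0P[a Aa]] := eqVneq A set0.
    by exists (exist _ p1 (conj sp1 (fun x => lexx _))).
  have [] := @sublinear_inf _ V T A (fun q => sval q) (fun x => - p1 (- x)).
  + by exists a.
  + move=> [q [sq qp]] x _ /=; rewrite lerNl; apply: le_trans (qp _).
    rewrite -subr_ge0 opprK; apply: le_trans (proj1 sq _ _).
    by rewrite addNr sublinear0.
  + by rewrite oppr0 sublinear0// oppr0.
  + by exists a => //; rewrite sublinear0//; case: (svalP a).
  + move=> q r x y Aq Ar; have := tA _ _ Aq Ar.
    move=> [|] /asboolP qr; [exists r => //|exists q => //].
      by apply: le_trans (proj1 (proj1 (svalP r)) _ _) _; rewrite lerD2r.
    by apply: le_trans (proj1 (proj1 (svalP q)) _ _) _; rewrite lerD2l.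
  + by move=> q c x Aq c0; exists q => //; rewrite (proj2 (proj1 (svalP q)))  ?(ltW c0).
  set r := fun x => _ => sr rA.
  have rp x : r x <= p1 x by apply: le_trans (rA _ _ Aa) (proj2 (svalP a) _).
  by exists (exist _ r (conj sr rp)) => s As; apply/asboolP => x; exact: rA.
move=> [L [sL Lp]] maxL.
have LN x : L (- x) = - L x.
  apply/eqP; rewrite eq_le; apply/andP; split; last first.
    rewrite -subr_ge0 opprK; apply: le_trans (proj1 sL _ _).
    by rewrite addNr sublinear0.
  have [q sq [qL qx]] := sublinear_split x sL.
  have qp y : q y <= p1 y by apply: le_trans (qL y) (Lp y).
  have lLq : le (exist _ L (conj sL Lp)) (exist _ q (conj sq qp)) by apply/asboolP.
  by have /asboolP/(_ (- x))/= := maxL _ lLq; move=> /le_trans; exact.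
exists L; split.
- move=> x y; apply/eqP; rewrite eq_le (proj1 sL)/=.
  by have := sublinear_ge x y sL; rewrite LN opprK.
- move=> c x; have [c0|c0] := leP 0 c; first exact: (proj2 sL).
  rewrite -[c]opprK scaleNr LN (proj2 sL) ?mulNr// oppr_ge0; exact: ltW.
- by move=> x; apply: le_trans (Lp x) (p1p x).
- apply/eqP; rewrite eq_le (le_trans (Lp v) (p1p v))/= -lerN2 -LN.
  exact: le_trans (Lp _) p1v.
Qed.

(** * Borel sets of metric spaces *)

Lemma open_Borel (R : realType) (X : pseudoPMetricType R) (A : set X) :
  open A -> measurable (A : set (Borel X)).
Proof. by move=> oA; exact: sub_sigma_algebra. Qed.

Lemma continuous_Borel (R : realType) (X Y : pseudoPMetricType R) (f : X -> Y) :
  continuous f -> measurable_fun [set: Borel X] (f : Borel X -> Borel Y).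
Proof.
move=> /continuousP cf.
apply: (@measurability _ _ (Borel X) (Borel Y) setT f (@open Y)) => //.
by move=> _ [A oA <-]; rewrite setTI; apply: open_Borel; exact: cf.
Qed.

Lemma continuous_Borel_real (R : realType) (X : pseudoPMetricType R) (f : X -> R) :
  continuous f -> measurable_fun [set: Borel X] (f : Borel X -> R).
Proof.
move=> /continuousP cf; apply: (measurability _ (RGenOInfty.measurableE R)).
move=> _ [_ [x ->] <-]; rewrite setTI; apply: open_Borel.
by apply: cf; exact: interval_open.
Qed.

Lemma bounded_integrable d (T : measurableType d) (R : realType)
    (P : probability T R) (f : T -> R) (M : R) :
  measurable_fun setT f -> (forall x, `|f x| <= M) ->
  P.-integrable setT (EFin \o f).
Proof.
move=> mf fM; apply: measurable_bounded_integrable => //.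
  by apply: le_lt_trans (probability_le1 P measurableT) _; rewrite ltry.
exists M; split; first exact: num_real.
by move=> N MN x _; exact: le_trans (fM x) (ltW MN).
Qed.

(** The function is the distance to the complement of [O], truncated at [1]; the truncation also
    covers an empty complement, where the distance is infinite. *)
Lemma open_bump (R : realType) (X : pseudoPMetricType R) (O : set X) :
  open O -> exists d : X -> R,
    [/\ continuous d, forall x, 0 <= d x <= 1 & forall x, O x <-> 0 < d x].
Proof.
move=> oO; pose D := edist_inf (~` O); pose d x := fine (mine 1%E (D x)).
have fin x : mine 1%E (D x) \is a fin_num.
  rewrite fin_numElt lt_min gt_min ltNyr ltry/= andbT.
  by rewrite ltNye edist_inf_neqNy.
have d01 x : 0 <= d x <= 1.
  rewrite -!lee_fin /d fineK// le_min ge_min lexx edist_inf_ge0/= andbT.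
  by rewrite lee_fin ler01.
exists d; split => // [x|x].
  apply: fine_cvg; rewrite fineK//; apply: continuous2_cvg.
  - exact: (@min_continuous _ (\bar R) (1%E, D x)).
  - exact: cvg_cst.
  - exact: edist_inf_continuous.
split=> [Ox|]; last first.
  apply: contraPP => nOx.
  by rewrite /d /D edist_inf0//; apply/negP; rewrite -leNgt /mine lte_fin ltr10.
have [r r0 rO] : exists2 r : R, 0 < r & ball x r `<=` O.
  by have /nbhs_ballP[r /= r0 rO] : nbhs x O by [exact: open_nbhs_nbhs]; exists r.
rewrite -lte_fin /d fineK// lt_min lte_fin ltr01/=.
apply: (@lt_le_trans _ _ r%:E); first by rewrite lte_fin.
apply: le_ereal_inf_tmp => _ [y nOy <-]; rewrite leNgt; apply/negP => /edist_lt_ball.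
by move=> /rO.
Qed.

(** With [d] the bump of [O], the functions [min 1 (k * d)] increase to the indicator of [O] and
    reach [1] at a finite stage at each point of [O]. The value [0] at stage [0] starts the
    telescoping sums of [daniell_open]. *)
Lemma open_approx (R : realType) (X : pseudoPMetricType R) (O : set X) :
  open O -> exists h : nat -> X -> R,
    [/\ forall k, continuous (h k), forall k x, 0 <= h k x <= 1,
        forall x, nondecreasing_seq (h ^~ x), forall k x, k = 0%N \/ ~ O x -> h k x = 0 &
        forall x, O x -> exists k, h k x = 1].
Proof.
move=> /open_bump[d [cd d01 Od]].
exists (fun k x => Num.min 1 (k%:R * d x)); split.
- move=> k x; apply: (@continuous2_cvg _ _ _ _ _ _ _ _ Num.min).
  - exact: (@min_continuous _ R (1, k%:R * d x)).
  - exact: cvg_cst.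
  - by apply: cvgM; [exact: cvg_cst|exact: cd].
- move=> k x; rewrite le_min ge_min lexx ler01/= andbT mulr_ge0//.
  by case/andP: (d01 x).
- move=> x m n mn; rewrite le_min ge_min lexx/= ge_min; apply/orP; right.
  by rewrite ler_wpM2r ?ler_nat//; case/andP: (d01 x).
- move=> k x [->|]; first by rewrite mul0r min_r// ler01.
  move=> /Od/negP; rewrite -leNgt => d0.
  have -> : d x = 0 by apply/eqP; rewrite eq_le d0; case/andP: (d01 x).
  by rewrite mulr0 min_r// ler01.
- move=> x /Od d0; exists (Num.truncn (d x)^-1).+1; apply: min_l.
  by rewrite -ler_pdivrMr// mul1r ltW// truncnS_gt.
Qed.

Lemma measure_open_limn (R : realType) (X : pseudoPMetricType R)
    (mu : {measure set (Borel X) -> \bar R}) (O : set X) (h : nat -> X -> R) :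
  open O -> (forall k, continuous (h k)) -> (forall k x, 0 <= h k x <= 1) ->
  (forall x, nondecreasing_seq (h ^~ x)) -> (forall k x, ~ O x -> h k x = 0) ->
  (forall x, O x -> exists k, h k x = 1) ->
  mu O = limn (fun k => \int[mu]_x (h k x)%:E)%E.
Proof.
move=> oO ch h01 nd h0 h1; rewrite -monotone_convergence//; last 3 first.
- by move=> k; apply/measurable_EFinP; apply: continuous_Borel_real; exact: ch.
- by move=> k x _; rewrite lee_fin; case/andP: (h01 k x).
- by move=> x _ m n mn; rewrite lee_fin; exact: nd.
rewrite -[in LHS](setIT O) -integral_indic//; last exact: open_Borel.
apply: eq_integral => x _; apply/esym/cvg_lim => //.
rewrite indicE; apply: cvg_near_cst; have [|nOx] := boolP (x \in O).
  rewrite inE => /h1[k hk]; exists k => // n /= kn.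
  congr EFin; apply/eqP; rewrite eq_le; case/andP: (h01 n x) => _ ->/=.
  by rewrite -[X in X <= _]hk; exact: nd.
apply: nearW => n; rewrite h0//; move: nOx; exact: contraNnot (@mem_set _ _ _).
Qed.

(** Open sets are stable under intersection and generate the Borel sets, and [measure_open_limn]
    expresses their measure through integrals of continuous functions. *)
Lemma eq_measure_continuous (R : realType) (X : pseudoPMetricType R)
    (mu nu : {measure set (Borel X) -> \bar R}) :
  (mu setT < +oo)%E ->
  (forall h : X -> R, continuous h -> (forall x, 0 <= h x <= 1) ->
    (\int[mu]_x (h x)%:E = \int[nu]_x (h x)%:E)%E) ->
  forall A : set (Borel X), measurable A -> mu A = nu A.
Proof.
move=> muoo hmn; apply: (@measure_unique _ R (Borel X) (@open X) (fun=> setT)) => //.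
- by move=> A B; exact: openI.
- by move=> _; exact: openT.
- by rewrite bigcup_const.
move=> A oA; have [h [ch h01 nd h0 h1]] := open_approx oA.
have h0' k x : ~ A x -> h k x = 0 by move=> Ax; apply: h0; right.
rewrite !(measure_open_limn _ oA ch)//; congr (limn _).
by apply/funext => k; exact: hmn.
Qed.

(** A single [e] works for all arrays, so that costs [L (h n)] and pointwise values [h n x] can be
    reindexed by the same enumeration. *)
Lemma nneseries_pair (R : realType) : exists e : nat -> nat * nat,
  forall a : nat -> nat -> \bar R, (forall i j, 0 <= a i j)%E ->
  (\sum_(p <oo) a (e p).1 (e p).2 = \sum_(i <oo) \sum_(j <oo) a i j)%E.
Proof.
have /card_esym/ppcard_eqP[f] := card_nat2.
exists f => a a0; rewrite nneseries_esumT//.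
transitivity (\esum_(i in [set: nat * nat]) a i.1 i.2)%E.
  by rewrite -(esum_image setT f (fun i => a i.1 i.2))// image_eq.
rewrite nneseries_esumT; last by move=> i; exact: nneseries_ge0.
under [RHS]eq_esum do rewrite nneseries_esumT//.
rewrite esum_esum//; congr esum; apply/seteqP; by split.
Qed.

(** * Riesz representation *)

Lemma continuous_bounded (R : realType) (X : topologicalType) (f : X -> R) :
  compact [set: X] -> continuous f -> exists M, forall x, `|f x| <= M.
Proof.
move=> cX cf; have : compact (f @` setT).
  by apply: continuous_compact => //; exact: continuous_subspaceT.
move=> /compact_bounded[M [_ Mf]]; exists (M + 1) => x.
by apply: (Mf (M + 1)); [rewrite ltrDl|exists x].
Qed.

Section riesz.
Context (R : realType) (X : pseudoPMetricType R) (L : (X -> R) -> R).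
Hypothesis LD : forall f g : X -> R, continuous f -> continuous g ->
  L (fun x => f x + g x) = L f + L g.
Hypothesis LZ : forall c (f : X -> R), continuous f ->
  L (fun x => c * f x) = c * L f.
Hypothesis Lge0 : forall f : X -> R, continuous f -> (forall x, 0 <= f x) -> 0 <= L f.
Hypothesis L1 : L (fun=> 1) = 1.

Let cstC (c : R) : continuous ((fun=> c) : X -> R).
Proof. exact: cst_continuous. Qed.

Let DC (f g : X -> R) : continuous f -> continuous g ->
  continuous (fun x => f x + g x).
Proof. by move=> cf cg x; apply: cvgD; [exact: cf|exact: cg]. Qed.

Let MC (f g : X -> R) : continuous f -> continuous g ->
  continuous (fun x => f x * g x).
Proof. by move=> cf cg x; apply: cvgM; [exact: cf|exact: cg]. Qed.

Let BC (f g : X -> R) : continuous f -> continuous g ->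
  continuous (fun x => f x - g x).
Proof. by move=> cf cg x; apply: cvgB; [exact: cf|exact: cg]. Qed.

Let sumC (h : nat -> X -> R) n : (forall k, continuous (h k)) ->
  continuous (fun x => \sum_(k < n) h k x).
Proof.
move=> ch; elim: n => [|n IH].
  by under eq_fun do rewrite big_ord0; exact: cstC.
by under eq_fun do rewrite big_ord_recr/=; exact: DC.
Qed.

Let Lcst c : L (fun=> c) = c.
Proof.
by rewrite -[RHS]mulr1 -L1 -LZ ?cstC//; congr L; apply/funext => x; rewrite mulr1.
Qed.

Let LB (f g : X -> R) : continuous f -> continuous g ->
  L (fun x => f x - g x) = L f - L g.
Proof.
move=> cf cg; apply/eqP; rewrite eq_sym subr_eq -LD//; last exact: BC.
by apply/eqP; congr L; apply/funext => x; rewrite subrK.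
Qed.

Let leL (f g : X -> R) : continuous f -> continuous g ->
  (forall x, f x <= g x) -> L f <= L g.
Proof.
move=> cf cg fg; rewrite -subr_ge0 -LB//; apply: Lge0; first exact: BC.
by move=> x; rewrite subr_ge0.
Qed.

Let Lsum (h : nat -> X -> R) n : (forall k, continuous (h k)) ->
  L (fun x => \sum_(k < n) h k x) = \sum_(k < n) L (h k).
Proof.
move=> ch; elim: n => [|n IH].
  by rewrite big_ord0 -[RHS]Lcst; congr L; apply/funext => x; rewrite big_ord0.
rewrite big_ord_recr/= -IH -LD//; last exact: sumC.
by congr L; apply/funext => x; rewrite big_ord_recr.
Qed.

(** Countable families of continuous functions dominating the indicator of [A]. The least total cost
    [daniell] is the Daniell outer measure of [L]; allowing countable families builds
    sigma-subadditivity in. *)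
Definition daniell_cover (A : set X) : set (nat -> X -> R) :=
  [set h : nat -> X -> R | [/\ forall n, continuous (h n), forall n x, 0 <= h n x &
    forall x, A x -> (1 <= \sum_(n <oo) (h n x)%:E)%E]].

Definition daniell (A : set X) : \bar R :=
  ereal_inf [set (\sum_(n <oo) (L (h n))%:E)%E | h in daniell_cover A].

Let cost_ge0 A h : daniell_cover A h -> forall n, (0 <= (L (h n))%:E)%E.
Proof. by move=> [ch h0 _] n; rewrite lee_fin Lge0. Qed.

Lemma daniell_ge0 A : (0 <= daniell A)%E.
Proof.
apply: le_ereal_inf_tmp => _ [h ch <-].
by apply: nneseries_ge0 => n _ _; exact: cost_ge0 ch n.
Qed.

Lemma le_daniell : {homo daniell : A B / A `<=` B >-> (A <= B)%E}.
Proof.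
move=> A B AB; apply: le_ereal_inf => _ [h [ch h0 hB] <-]; exists h => //.
by split=> // x /AB; exact: hB.
Qed.

Lemma daniell_le A (g : X -> R) : continuous g -> (forall x, 0 <= g x) ->
  (forall x, A x -> 1 <= g x) -> (daniell A <= (L g)%:E)%E.
Proof.
(* The single function [g], padded with zeros, is a cover. *)
move=> cg g0 gA; pose h n := if n is 0%N then g else fun=> 0.
have sum0 (F : nat -> R) : (forall n, F n.+1 = 0) ->
    (\sum_(n <oo) (F n)%:E = (F 0%N)%:E)%E.
  move=> F0; apply/cvg_lim => //; apply: cvg_near_cst; exists 1%N => // -[|n]// _.
  by rewrite big_nat_recl// big1 ?adde0// => i _; rewrite F0.
rewrite -(sum0 (fun n => L (h n))); last by move=> n; exact: Lcst.
apply: ereal_inf_lbound; exists h => //; split.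
- by move=> [|n] //; exact: cstC.
- by move=> [|n] x //=.
- by move=> x Ax; rewrite sum0// lee_fin; exact: gA.
Qed.

Lemma daniell_fin A : daniell A \is a fin_num.
Proof.
rewrite ge0_fin_numE ?daniell_ge0//; apply: (@le_lt_trans _ _ (L (fun=> 1))%:E).
  exact: daniell_le (@cstC 1) _ _.
exact: ltry.
Qed.

Lemma daniell0 : daniell set0 = 0%E.
Proof.
apply/eqP; rewrite eq_le daniell_ge0 andbT.
by have := @daniell_le set0 (fun=> 0) (@cstC 0); rewrite Lcst; exact.
Qed.

(** Covers of the [A n] that are optimal up to [eps / 2 ^ n.+1] are merged into one cover of the
    union along the enumeration of [nneseries_pair]. *)
Lemma daniell_sigma_subadditive : sigma_subadditive daniell.
Proof.
move=> A; have [e ee] := nneseries_pair R.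
suff add_eps (eps : {posnum R}) :
    (daniell (\bigcup_n A n) <= \sum_(i <oo) daniell (A i) + eps%:num%:E)%E.
  by apply/lee_addgt0Pr => _/posnumP[].
rewrite (le_trans _ (epsilon_trick _ _ _))//; last by move=> n; exact: daniell_ge0.
have [G GP] : {G : nat -> nat -> X -> R & forall n, daniell_cover (A n) (G n) /\
   (\sum_(k <oo) (L (G n k))%:E <= daniell (A n) + (eps%:num / (2 ^ n.+1)%:R)%:E)%E}.
  apply: (@choice _ _ (fun n (g : nat -> X -> R) => daniell_cover (A n) g /\
    (\sum_(k <oo) (L (g k))%:E <= daniell (A n) + (eps%:num / (2 ^ n.+1)%:R)%:E)%E)).
  move=> n; have en : 0 < eps%:num / (2 ^ n.+1)%:R by [].
  have [_ [g gA <-] /ltW gle] := lb_ereal_inf_adherent en (daniell_fin (A n)).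
  by exists g.
have G0 i j x : 0 <= G i j x by have [[_ + _] _] := GP i; exact.
have cG i j : continuous (G i j) by have [[+ _ _] _] := GP i; exact.
apply: (@le_trans _ _ (\sum_(i <oo) \sum_(j <oo) (L (G i j))%:E)%E); last first.
  apply: lee_nneseries => [i _ _|i _]; last by have [] := GP i.
  by apply: nneseries_ge0 => j _ _; rewrite lee_fin Lge0.
rewrite -(ee (fun i j => (L (G i j))%:E)); last first.
  by move=> i j; rewrite lee_fin Lge0.
apply: ereal_inf_lbound; exists (fun p => G (e p).1 (e p).2) => //; split=> //.
move=> x [i _ Aix]; rewrite (ee (fun i j => (G i j x)%:E)); last first.
  by move=> *; rewrite lee_fin.
apply: le_trans (nneseries_lim_ge i.+1 _); last first.
  by move=> k _ _; apply: nneseries_ge0 => j _ _; rewrite lee_fin.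
rewrite big_nat_recr//=; have [[_ _ /(_ _ Aix) h1] _] := GP i.
apply: le_trans h1 _; rewrite leeDr// sume_ge0// => k _.
by apply: nneseries_ge0 => j _ _; rewrite lee_fin.
Qed.

(* If [phi k] increases to the indicator of [O] and [d k] are its increments, a cover
   [g] of [A] splits into the cover [g n * d k] of [A `&` O] and, for every [K], the
   cover [g n * (1 - phi K)] of [A `&` ~` O]; [sum_a] balances the costs. *)
Lemma daniell_open (O A : set X) : open O ->
  (daniell (A `&` O) + daniell (A `&` ~` O) <= daniell A)%E.
Proof.
move=> /open_approx[phi [cphi phi01 ndphi phi0 phi1]].
apply: le_ereal_inf_tmp => _ [g [cg g0 gA] <-].
pose d k x := phi k.+1 x - phi k x.
have d0 k x : 0 <= d k x by rewrite subr_ge0; exact: ndphi.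
have cd k : continuous (d k) by exact: BC.
have cphi1 k : continuous (fun x => 1 - phi k x) by apply: BC; first exact: cstC.
have phi10 k x : 0 <= 1 - phi k x by rewrite subr_ge0; case/andP: (phi01 k x).
pose a k := (\sum_(n <oo) (L (fun x => g n x * d k x))%:E)%E.
pose b k := (\sum_(n <oo) (L (fun x => g n x * (1 - phi k x)))%:E)%E.
have La0 n k : 0 <= L (fun x => g n x * d k x).
  by apply: Lge0 => [|x]; [exact: MC|exact: mulr_ge0].
have Lb0 n k : 0 <= L (fun x => g n x * (1 - phi k x)).
  by apply: Lge0 => [|x]; [exact: MC|exact: mulr_ge0].
have sum_a K : (\sum_(0 <= k < K) a k + b K = \sum_(n <oo) (L (g n))%:E)%E.
  elim: K => [|K <-].
    rewrite big_geq// add0e; apply: eq_eseriesr => n _; congr (L _)%:E.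
    by apply/funext => x; rewrite phi0 ?subr0 ?mulr1//; left.
  rewrite big_nat_recr//= -addeA; congr (_ + _)%E; rewrite /a /b -nneseriesD//.
  - apply: eq_eseriesr => n _; rewrite -EFinD -LD; [|exact: MC|exact: MC].
    congr (L _)%:E; apply/funext => x; rewrite -mulrDr; congr (_ * _).
    by rewrite /d; ring.
  - by move=> *; rewrite lee_fin.
  - by move=> *; rewrite lee_fin.
apply: (@le_trans _ _ (\sum_(k <oo) a k + daniell (A `&` ~` O))%E).
  rewrite leeD2r//; have [e ee] := nneseries_pair R.
  rewrite /a -(ee (fun k n => (L (fun x => g n x * d k x))%:E)); last first.
    by move=> *; rewrite lee_fin.
  apply: ereal_inf_lbound; exists (fun p x => g (e p).2 x * d (e p).1 x) => //.
  split=> [p|p x|x [Ax /phi1[K phiK]]]; [exact: MC|exact: mulr_ge0|].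
  rewrite (ee (fun k n => (g n x * d k x)%:E)); last first.
    by move=> *; rewrite lee_fin mulr_ge0.
  apply: le_trans (nneseries_lim_ge K _); last first.
    by move=> k _ _; apply: nneseries_ge0 => n _ _; rewrite lee_fin mulr_ge0.
  apply: le_trans (gA _ Ax) _.
  (* At this point [phi K x = 1] and [phi 0 x = 0], so the increments [d k x] with [k < K] sum to
     [1]. *)
  have -> : (\sum_(n <oo) (g n x)%:E =
      \sum_(0 <= k < K) ((d k x)%:E * \sum_(n <oo) (g n x)%:E))%E.
    rewrite -ge0_sume_distrl; last by move=> *; rewrite lee_fin.
    by rewrite sumEFin telescope_sumr// phiK phi0 ?subr0 ?mul1e//; left.
  apply: lee_sum => k _; rewrite -nneseriesZl; last by move=> *; rewrite lee_fin.
  apply: lee_nneseries => n *; first by rewrite -EFinM lee_fin mulr_ge0.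
  by rewrite -EFinM mulrC.
have bO K : (daniell (A `&` ~` O) <= b K)%E.
  apply: ereal_inf_lbound; exists (fun n x => g n x * (1 - phi K x)) => //.
  split=> [n|n x|x [Ax Ox]]; [exact: MC|exact: mulr_ge0|].
  apply: le_trans (gA _ Ax) _; apply: lee_nneseries => n *; first by rewrite lee_fin.
  by rewrite phi0 ?subr0 ?mulr1//; right.
rewrite -leeBrDr ?daniell_fin//; apply: lime_le.
  by apply: is_cvg_nneseries => k _ _; apply: nneseries_ge0 => n _ _; rewrite lee_fin.
by apply: nearW => K; rewrite leeBrDr ?daniell_fin// -(sum_a K) leeD2l.
Qed.

Hypothesis cX : compact [set: X].

(** For the lower bound, the open sets where a partial sum of a cover exceeds [1 - eps] cover [X]
    and grow with the number of terms. By compactness one partial sum is at least [1 - eps]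
    everywhere, and monotonicity of [L] bounds its cost from below. *)
Lemma daniell_setT : daniell setT = 1%E.
Proof.
apply/eqP; rewrite eq_le; apply/andP; split.
  by have := @daniell_le setT (fun=> 1) (@cstC 1); rewrite L1; exact.
apply: le_ereal_inf_tmp => _ [g [cg g0 gT] <-].
apply/lee_addgt0Pr => eps eps0.
pose V N := [set x | 1 - eps < \sum_(k < N) g k x].
have oV N : open (V N).
  by have /continuousP/(_ _ (@open_gt _ (1 - eps))) := @sumC g N cg.
have covV : [set: X] `<=` cover [set: nat] V.
  move=> x _; have := gT x I; rewrite leNgt => /negP gx.
  apply: contrapT => nV; apply: gx; apply: (@le_lt_trans _ _ (1 - eps)%:E).
    apply: lime_le; first by apply: is_cvg_nneseries => *; rewrite lee_fin.
    apply: nearW => N; rewrite sumEFin lee_fin big_mkord leNgt; apply/negP => VN.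
    by apply: nV; exists N.
  by rewrite lte_fin ltrBlDr ltrDl.
move: cX; rewrite compact_cover => /(_ _ _ V (fun i _ => oV i) covV)[D _ DV].
pose N := (\max_(i <- finmap.enum_fset D) i)%N.
have gN x : 1 - eps <= \sum_(k < N) g k x.
  have [i iD Vix] := DV x I; apply: ltW; apply: lt_le_trans Vix _.
  rewrite -!(big_mkord xpredT (g ^~ x)); have iN : (i <= N)%N by exact: leq_bigmax_seq.
  by rewrite (big_cat_nat _ iN)//= lerDl sumr_ge0.
rewrite -leeBlDr//; apply: (@le_trans _ _ (\sum_(0 <= k < N) (L (g k))%:E)%E).
  rewrite sumEFin -EFinB lee_fin big_mkord -Lsum// -(Lcst (1 - eps)).
  by apply: leL => //; exact: sumC.
by apply: nneseries_lim_ge => k _ _; rewrite lee_fin Lge0.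
Qed.

(** Caratheodory's construction: [daniell_open] makes open sets, hence Borel sets, measurable for
    the outer measure. *)
Lemma daniell_probability :
  exists mu : probability (Borel X) R, forall A, mu A = daniell A.
Proof.
pose om := @isOuterMeasure.Build R X daniell daniell0 daniell_ge0 le_daniell
  daniell_sigma_subadditive.
pose OM : {outer_measure set X -> \bar R} := HB.pack daniell om.
have cara (A : set (Borel X)) : measurable A -> OM.-caratheodory A.
  apply: smallest_sub; last first.
    by move=> O oO; apply: le_caratheodory_measurable => B; exact: daniell_open.
  split.
  - exact: caratheodory_measurable_set0.
  - by move=> B; rewrite setTD; exact: caratheodory_measurable_setC.
  - by move=> F; exact: caratheodory_measurable_bigcup.
have sa : semi_sigma_additive (daniell : set (Borel X) -> \bar R).
  move=> F mF tF mUF; have := @caratheodory_measure_sigma_additive R X OM F.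
  by apply => // [i|]; exact: cara.
pose m0 := @isMeasure.Build _ (Borel X) R daniell daniell0 daniell_ge0 sa.
pose M : {measure set (Borel X) -> \bar R} := HB.pack daniell m0.
pose p0 := @Measure_isProbability.Build _ (Borel X) R M daniell_setT.
pose P : probability (Borel X) R := HB.pack daniell p0 M.
by exists P.
Qed.

(** Slicing into layers of height one gives [int_up]; scaling by a large [N] turns it into [int_le].
    Applying that to [1 - f] as well gives equality for values in [[0, 1]], and an affine rescaling
    reaches every continuous [f]. *)
Theorem riesz_representation : exists mu : probability (Borel X) R,
  forall f : X -> R, continuous f -> \int[mu]_x f x = L f.
Proof.
have [mu muE] := daniell_probability; exists mu.
have icont (g : X -> R) : continuous g -> mu.-integrable setT (EFin \o g).
  move=> cg; have [M gM] := continuous_bounded cX cg.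
  apply: (@bounded_integrable _ (Borel X) R mu g M) => //.
  exact: continuous_Borel_real.
have int_cst (c : R) : \int[mu]_x c = c.
  have muT : fine (mu setT) = 1 by rewrite muE daniell_setT.
  by rewrite -[RHS]mulr1 -muT; exact: Rintegral_cst.
pose low (g : X -> R) x := Num.min (g x) 1.
pose up (g : X -> R) x := Num.max (g x - 1) 0.
have clow (g : X -> R) : continuous g -> continuous (low g).
  move=> cg x; apply: (@continuous2_cvg _ _ _ _ _ _ _ _ Num.min).
  - exact: (@min_continuous _ R (g x, 1)).
  - exact: cg.
  - exact: cvg_cst.
have cup (g : X -> R) : continuous g -> continuous (up g).
  move=> cg x; apply: (@continuous2_cvg _ _ _ _ _ _ _ _ Num.max).
  - exact: (@max_continuous _ R (g x - 1, 0)).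
  - by apply: cvgB; [exact: cg|exact: cvg_cst].
  - exact: cvg_cst.
have lowup (g : X -> R) x : g x = low g x + up g x.
  by rewrite /low /up; case: (leP (g x) 1) => h; [rewrite max_r ?addr0 ?subr_le0|
    rewrite max_l ?subr_ge0 ?(ltW h)// addrC subrK].
have up0 (g : X -> R) x : 0 <= up g x by rewrite le_max lexx orbT.
(* Layer by layer: [low g] is supported where [0 < g] and is [1] where [1 <= g], so
   shifting by one layer trades the integral of [low (up g)] for [L (low g)]. *)
have int_up (N : nat) (g : X -> R) : continuous g -> (forall x, 0 <= g x <= N%:R) ->
    \int[mu]_x (up g x) <= L g.
  elim: N g => [|N IH] g cg gN.
    have -> : up g = fun=> 0.
      apply/funext => x; rewrite /up max_r// subr_le0.
      by apply: le_trans ler01; case/andP: (gN x).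
    rewrite int_cst; apply: Lge0 => // x.
    by case/andP: (gN x).
  have mA : measurable ([set x | 1 <= g x] : set (Borel X)).
    have -> : [set x | 1 <= g x] = ~` (g @^-1` [set y | y < 1]).
      by apply/seteqP; split => x /=; rewrite leNgt => /negP.
    apply: measurableC; apply: open_Borel.
    by have /continuousP := cg; apply; exact: open_lt.
  have -> : \int[mu]_x up g x = \int[mu]_x (low (up g) x + up (up g) x).
    by apply: eq_Rintegral => x _; exact: lowup.
  rewrite RintegralD//; [|exact/icont/clow/cup|exact/icont/cup/cup].
  have -> : L g = L (low g) + L (up g).
    rewrite -LD; [|exact: clow|exact: cup].
    by congr L; apply/funext => x; exact: lowup.
  rewrite lerD//; last first.
    apply: IH; first exact: cup.
    move=> x; rewrite up0/= /up ge_max lerBlDr natr1 ler0n andbT.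
    by case/andP: (gN x).
  apply: (@le_trans _ _ (fine (mu [set x | 1 <= g x]))).
    have -> : fine (mu [set x | 1 <= g x]) = \int[mu]_x (\1_[set x | 1 <= g x] x).
      by rewrite /Rintegral integral_indic// setIT.
    apply: le_Rintegral => //; first exact/icont/clow/cup.
      apply: (@bounded_integrable _ (Borel X) R mu _ 1).
        exact: measurable_indic.
      by move=> x; rewrite indicE; case: (_ \in _); rewrite ?normr0 ?normr1.
    move=> x _; rewrite indicE; have [_|] := boolP (x \in _).
      by rewrite ge_min lexx orbT.
    rewrite notin_setE/= => /negP; rewrite -ltNge => g1.
    by rewrite /low /up ge_min max_r ?lexx// subr_le0 ltW.
  rewrite muE -lee_fin fineK ?daniell_fin//; apply: daniell_le; first exact: clow.
    by move=> x; rewrite le_min ler01 andbT; case/andP: (gN x).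
  by move=> x /= gx; rewrite le_min gx lexx.
have int_le (f : X -> R) : continuous f -> (forall x, 0 <= f x <= 1) ->
    \int[mu]_x f x <= L f.
  move=> cf f01; apply/ler_addgt0Pr => eps eps0.
  (* Passing from [N * f] to [up (N * f)] loses at most [1], which is at most [eps] after division
     by [N]. *)
  pose N := (Num.truncn eps^-1).+1; have N0 : 0 < N%:R :> R by rewrite ltr0n.
  have cNf : continuous (fun x => N%:R * f x) by apply: MC => //; exact: cstC.
  have Nf x : 0 <= N%:R * f x <= N%:R.
    by case/andP: (f01 x) => f0 f1; rewrite mulr_ge0 ?ler_piMr// ltW.
  have := int_up N _ cNf Nf; rewrite LZ// => upL.
  suff : N%:R * \int[mu]_x f x <= N%:R * (L f + eps) by rewrite ler_pM2l.
  rewrite -RintegralZl//; last exact: icont.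
  apply: (@le_trans _ _ (\int[mu]_x (up (fun x => N%:R * f x) x + 1))).
    apply: le_Rintegral => //; [exact: icont| |].
      by apply: icont; apply: DC; [exact: cup|exact: cstC].
    by move=> x _; rewrite -lerBlDr le_max lexx.
  rewrite RintegralD//; [|exact/icont/cup|exact/icont/cstC].
  rewrite int_cst mulrDr lerD// mulrC.
  by rewrite -ler_pdivrMl// mulr1 ltW// truncnS_gt.
have int_eq (f : X -> R) : continuous f -> (forall x, 0 <= f x <= 1) ->
    \int[mu]_x f x = L f.
  move=> cf f01; apply/eqP; rewrite eq_le int_le//=.
  have := int_le (fun x => 1 - f x).
  rewrite LB// L1.
  rewrite RintegralB//; [|exact/icont/cstC|exact: icont].
  rewrite int_cst lerD2l lerN2; apply.
    by apply: BC => //; exact: cstC.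
  by move=> x; rewrite subr_ge0 lerBlDr lerDl andbC.
move=> f cf; have [M0 fM0] := continuous_bounded cX cf.
pose M := `|M0| + 1; have M_gt0 : 0 < M by rewrite ltr_wpDl.
have fM x : `|f x| <= M.
  by apply: le_trans (fM0 x) _; apply: le_trans (ler_norm _) _; rewrite lerDl.
pose g x := (2 * M)^-1 * (f x + M).
have cfM : continuous (fun x => f x + M) by apply: DC => //; exact: cstC.
have cg : continuous g by apply: MC => //; exact: cstC.
have M2 : 0 < 2 * M by rewrite mulr_gt0.
have : \int[mu]_x g x = L g.
  apply: int_eq => // x; have := fM x; rewrite ler_norml => /andP[h1 h2].
  rewrite /g mulr_ge0 ?invr_ge0 ?(ltW M2)//=; last by rewrite -lerBlDr sub0r.
  by rewrite ler_pdivrMl// mulr1 mulr_natl mulr2n lerD2r.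
rewrite RintegralZl//; last exact: icont.
rewrite LZ// => /(mulfI (lt0r_neq0 _)); rewrite invr_gt0 => /(_ M2).
rewrite LD// Lcst.
rewrite RintegralD//; [|exact: icont|exact/icont/cstC].
by rewrite int_cst => /addIr.
Qed.

End riesz.

(** * Maximal and pointwise ergodic theorems *)

(** The limit is the supremum of the slopes [a] for which [a * n - s n] stays bounded above; [- B]
    is such a slope and [B] bounds them all. *)
Lemma cvg_average (R : realType) (s : nat -> R) (B : R) :
  (forall n, `|s n| <= n%:R * B) ->
  (forall a b : rat, a < b ->
    (exists C : R, forall n, s n - ratr b * n%:R <= C) \/
    (exists C : R, forall n, ratr a * n%:R - s n <= C)) ->
  cvgn (fun n => n%:R^-1 * s n).
Proof.
move=> sB osc.
pose A := [set a : R | exists C : R, forall n, a * n%:R - s n <= C].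
have A0 : A (- B).
  exists 0 => n; have := sB n; rewrite ler_norml => /andP[h _].
  by rewrite subr_le0 mulNr mulrC.
have AB : ubound A B.
  move=> a [C aC]; rewrite leNgt; apply/negP => Ba.
  have aB : 0 < a - B by rewrite subr_gt0.
  have [n nC] : exists n : nat, C < n%:R * (a - B).
    exists (Num.truncn (C / (a - B))).+1; rewrite -ltr_pdivrMr//.
    exact: truncnS_gt.
  have := aC n; have := sB n; rewrite ler_norml => /andP[_ h].
  by rewrite mulrBr in nC; rewrite mulrC; lra.
have supA : has_sup A by split; [exists (- B)|exists B].
apply/cvg_ex; exists (sup A); apply/cvgrPdist_le => eps eps0.
have [e e0 epsE] : exists2 e, 0 < e & eps = e + e.
  by exists (eps / 2); [rewrite divr_gt0|rewrite -splitr].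
have [a [Ca aC] ta] := sup_adherent e0 supA.
(* Since [q1] exceeds the supremum, the second alternative fails for the pair [q1 < q2]; the first
   bounds [s n] above with slope [q2], which is below [sup A + e]. *)
have /rat_in_itvoo[q1] : sup A < sup A + e by rewrite ltrDl.
rewrite in_itv/= => /andP[tq1 q1e].
have /rat_in_itvoo[q2] := q1e; rewrite in_itv/= ltr_rat => /andP[q12 q2e].
have [[Cb bC]|] := osc _ _ q12; last first.
  by move=> /(ub_le_sup (proj2 supA)); rewrite leNgt tq1.
near=> n; set N : R := n%:R.
have n0 : 0 < N by rewrite ltr0n; near: n; exists 1%N.
have Cn : Num.max Ca Cb <= N * e.
  rewrite -ler_pdivrMr//; apply: ltW; apply: lt_le_trans (truncnS_gt _) _.
  by rewrite ler_nat; near: n; exact: nbhs_infty_ge.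
move: Cn; rewrite ge_max => /andP[Can Cbn].
have lo : sup A - (e + e) <= N^-1 * s n.
  rewrite ler_pdivlMl// (_ : _ * _ = (sup A - e) * N - N * e); last by ring.
  rewrite lerBlDr; apply: (@le_trans _ _ (a * N)); first by rewrite ler_wpM2r ?ltW.
  by rewrite -lerBlDl; exact: le_trans (aC n) Can.
have hi : N^-1 * s n <= sup A + (e + e).
  rewrite ler_pdivrMl// (_ : _ * _ = N * e + (sup A + e) * N); last by ring.
  apply: (@le_trans _ _ (Cb + ratr q2 * N)); first by rewrite -lerBlDr.
  by rewrite lerD// ler_wpM2r ?ltW.
by rewrite epsE distrC ler_distl lo hi.
Unshelve. all: by end_near. Qed.

Lemma Rintegral_pushforward d1 d2 (T1 : measurableType d1) (T2 : measurableType d2)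
    (R : realType) (P : probability T1 R) (Q : probability T2 R) (phi : T1 -> T2)
    (f : T2 -> R) (B : R) :
  measurable_fun setT phi ->
  (forall A, measurable A -> P (phi @^-1` A) = Q A) ->
  measurable_fun setT f -> (forall x, `|f x| <= B) ->
  \int[P]_x f (phi x) = \int[Q]_x f x.
Proof.
move=> mphi PQ mf fB; congr fine.
have mfphi : measurable_fun setT (f \o phi) by exact: measurableT_comp.
rewrite -(integral_pushforward mphi (mu := P) (D := setT) (f := EFin \o f))//.
- by apply: eq_measure_integral => A mA _; exact: PQ.
- exact/measurable_EFinP.
- rewrite preimage_setT.
  by apply: (@bounded_integrable _ _ _ P _ B mfphi) => x; exact: fB.
Qed.

Section birkhoff.
Context d (T : measurableType d) (R : realType) (P : probability T R) (U : T -> T).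
Hypothesis mU : measurable_fun setT U.
Hypothesis PU : forall A, measurable A -> P (U @^-1` A) = P A.

Definition birkhoff_sum (f : T -> R) (k : nat) (x : T) : R :=
  \sum_(j < k) f (iter j U x).

Lemma birkhoff_sumS f k x :
  birkhoff_sum f k.+1 x = f x + birkhoff_sum f k (U x).
Proof.
rewrite /birkhoff_sum big_ord_recl/=; congr (_ + _).
by apply: eq_bigr => j _; rewrite -iterS iterSr.
Qed.

Lemma measurable_iter k : measurable_fun setT (iter k U).
Proof.
elim: k => [|k IH]; first exact: measurable_id.
exact: (measurableT_comp mU IH).
Qed.

Lemma measurable_birkhoff_sum f k :
  measurable_fun setT f -> measurable_fun setT (birkhoff_sum f k).
Proof.
move=> mf; apply: measurable_sum => j.
exact: (measurableT_comp mf (measurable_iter j)).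
Qed.

(* The maximum of [birkhoff_sum f k x] over [k <= n]. *)
Fixpoint maximal_sum (f : T -> R) (n : nat) (x : T) : R :=
  if n is n'.+1 then Num.max 0 (f x + maximal_sum f n' (U x)) else 0.

Lemma maximal_sum_ge0 f n x : 0 <= maximal_sum f n x.
Proof. by case: n => [|n] //=; rewrite le_max lexx. Qed.

Lemma maximal_sumS f n x : maximal_sum f n x <= maximal_sum f n.+1 x.
Proof.
elim: n x => [|n IH] x; first exact: maximal_sum_ge0.
by rewrite [leLHS]/= [leRHS]/= le_max2 // lerD2l; exact: IH.
Qed.

Lemma maximal_sum_nd f x : nondecreasing_seq (maximal_sum f ^~ x).
Proof. by apply/nondecreasing_seqP => n; exact: maximal_sumS. Qed.

Lemma birkhoff_sum_le_maximal f n x : birkhoff_sum f n x <= maximal_sum f n x.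
Proof.
elim: n x => [|n IH] x; first by rewrite /birkhoff_sum big_ord0.
by rewrite birkhoff_sumS /= le_max lerD2l IH orbT.
Qed.

Lemma measurable_maximal_sum f n :
  measurable_fun setT f -> measurable_fun setT (maximal_sum f n).
Proof.
move=> mf; elim: n => [|n IH] /=; first exact: measurable_cst.
apply: measurable_maxr; first exact: measurable_cst.
by apply: measurable_funD => //; exact: (measurableT_comp IH mU).
Qed.

Lemma maximal_sum_bounded f (B : R) n x : 0 <= B -> (forall x, `|f x| <= B) ->
  `|maximal_sum f n x| <= n%:R * B.
Proof.
move=> B0 fB; rewrite ger0_norm ?maximal_sum_ge0//.
elim: n x => [|n IH] x /=; first by rewrite mul0r.
rewrite ge_max mulr_ge0//= -natr1 mulrDl mul1r addrC lerD//.
exact: le_trans (ler_norm _) (fB x).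
Qed.

(* Garsia: with [M] a maximal sum, [M - M o U <= f] except on the shrinking sets [D n],
   where it is at most [f + B]; the left-hand side has integral [0]. *)
Lemma maximal_ergodic (f : T -> R) (B : R) : measurable_fun setT f ->
  (forall x, `|f x| <= B) ->
  P.-negligible [set x | f x < 0 /\ forall k, birkhoff_sum f k x <= 0] ->
  0 <= \int[P]_x f x.
Proof.
move=> mf fB negl.
have B0 : 0 <= B by exact: le_trans (normr_ge0 (f point)) (fB point).
have iP (g : T -> R) M : measurable_fun setT g -> (forall x, `|g x| <= M) ->
  P.-integrable setT (EFin \o g) by exact: bounded_integrable.
pose D n := [set x | f x < 0] `&` [set x | maximal_sum f n x <= 0].
have mD n : measurable (D n).
  apply: measurableI.
    have -> : [set x | f x < 0] = f @^-1` `]-oo, 0[ .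
      by apply/seteqP; split => x; rewrite /= in_itv.
    by rewrite -[X in measurable X]setTI; apply: mf.
  have -> : [set x | maximal_sum f n x <= 0] = maximal_sum f n @^-1` `]-oo, 0] .
    by apply/seteqP; split => x; rewrite /= in_itv.
  by rewrite -[X in measurable X]setTI; apply: measurable_maximal_sum.
have mid n : 0 <= \int[P]_x f x + B * fine (P (D n.+1)).
  set M := maximal_sum f n.+1.
  have mM : measurable_fun setT M by exact: measurable_maximal_sum.
  have MB x : `|M x| <= n.+1%:R * B by exact: maximal_sum_bounded.
  have iM := iP _ _ mM MB.
  have iMU : P.-integrable setT (EFin \o (M \o U)).
    apply: (iP _ (n.+1%:R * B)); first exact: measurableT_comp.
    by move=> x; exact: MB.
  have i1 : P.-integrable setT (EFin \o (\1_(D n.+1) : T -> R)).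
    apply: (iP _ 1); first exact: measurable_indic.
    by move=> x; rewrite indicE; case: (_ \in _); rewrite ?normr0 ?normr1.
  have mB1 : measurable_fun setT (fun x => B * \1_(D n.+1) x).
    by apply: measurable_funM => //; exact: measurable_indic.
  have iB1 : P.-integrable setT (EFin \o (fun x => B * \1_(D n.+1) x)).
    apply: (iP _ B mB1).
    move=> x; rewrite indicE; case: (_ \in _); rewrite ?mulr1 ?mulr0 ?normr0//.
    by rewrite ger0_norm.
  have if_ : P.-integrable setT (EFin \o f) by exact: iP mf fB.
  have -> : fine (P (D n.+1)) = \int[P]_x \1_(D n.+1) x.
    by rewrite /Rintegral integral_indic// setIT.
  rewrite -RintegralZl// -RintegralD//.
  (* Invariance of [P] makes the integral of the coboundary vanish. *)
  have -> : 0 = \int[P]_x (M x - M (U x)) :> R.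
    by rewrite RintegralB// (Rintegral_pushforward mU PU mM MB) subrr.
  apply: le_Rintegral => //.
  - apply: (iP _ (n.+1%:R * B + n.+1%:R * B)).
      by apply: measurable_funB => //; exact: (measurableT_comp mM mU).
    by move=> x; apply: le_trans (ler_normB _ _) _; rewrite lerD.
  - apply: (iP _ (B + B)).
      exact: measurable_funD.
    move=> x; apply: le_trans (ler_normD _ _) _; rewrite lerD// indicE.
    by case: (_ \in _); rewrite ?mulr1 ?mulr0 ?normr0 ?ger0_norm.
  move=> x _; have B1 : 0 <= B * \1_(D n.+1) x by rewrite indicE mulr_ge0.
  (* If [M x > 0], the recursion gives [M x <= f x + M (U x)]. Otherwise [M x - M (U x) <= 0], which
     suffices when [f x >= 0]; when [f x < 0] the point lies in [D n.+1] and [f x + B >= 0]. *)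
  have [Mx|Mx] := ltP 0 (M x).
    have -> : M x = f x + maximal_sum f n (U x).
      by move: Mx; rewrite /M /= lt_max ltxx/= => Mx; rewrite max_r// ltW.
    have := maximal_sumS f n (U x); rewrite -/M; lra.
  have MU0 : 0 <= M (U x) by exact: maximal_sum_ge0.
  have [fx|fx] := leP 0 (f x); first by lra.
  have xD : x \in D n.+1 by rewrite inE.
  have := fB x; rewrite ler_norml indicE xD mulr1 => /andP[fx' _]; lra.
(* A point in all the [D n.+1] has [f x < 0] and no positive Birkhoff sum, so it lies in the
   negligible set; continuity from above applies. *)
have PD0 : P (D n.+1) @[n --> \oo] --> 0%E.
  have <- : P (\bigcap_n D n.+1) = 0%E.
    apply: measure_negligible; first by apply: bigcapT_measurable.
    apply: negligibleS negl => x Dx; split; first by have [] := Dx 0%N I.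
    move=> k; have [_ /= Mx] := Dx k I; apply: le_trans _ Mx.
    exact: le_trans (birkhoff_sum_le_maximal f k x) (maximal_sumS _ _ _).
  apply: nonincreasing_cvg_mu => //.
  - by apply: le_lt_trans (probability_le1 P (mD 1%N)) _; rewrite ltry.
  - exact: bigcapT_measurable.
  - move=> m n mn; apply/subsetPset => x [fx Mx]; split => //.
    by apply: le_trans _ Mx; exact: maximal_sum_nd.
rewrite leNgt; apply/negP => If.
have : (\int[P]_x f x + B * fine (P (D n.+1))) @[n --> \oo] --> \int[P]_x f x.
  rewrite -[X in _ --> X]addr0 -[X in _ --> _ + X](mulr0 B).
  apply: cvgD; first exact: cvg_cst.
  by apply: cvgM; [exact: cvg_cst|exact: fine_cvg].
move=> /(cvgr_lt _)/(_ _ If)[N _ /(_ N (leqnn _))]/=.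
by rewrite ltNge mid.
Qed.

(** Natural thresholds present the set as a countable intersection, as measurability requires. *)
Definition divergent_sums (g : T -> R) : set T :=
  [set x | forall C : nat, exists n, C%:R < birkhoff_sum g n x].

Lemma measurable_divergent_sums g :
  measurable_fun setT g -> measurable (divergent_sums g).
Proof.
move=> mg; have -> : divergent_sums g =
    \bigcap_(C : nat) \bigcup_n (birkhoff_sum g n @^-1` `]C%:R, +oo[).
  apply/seteqP; split => [x gx C _|x gx C].
    by have [n nC] := gx C; exists n => //=; rewrite in_itv/= nC.
  by have [n _] := gx C I; rewrite /= in_itv/= andbT => nC; exists n.
apply: bigcapT_measurable => C; apply: bigcupT_measurable => n.
by rewrite -[X in measurable X]setTI; apply: measurable_birkhoff_sum.
Qed.

Lemma divergent_sums_iter g x j : divergent_sums g x -> divergent_sums g (iter j U x).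
Proof.
move=> gx; elim: j => // j; rewrite iterS; move: (iter j U x) => {x gx} x gx C.
(* Dropping the first term changes the sum by [g x], so the threshold is raised by more than
   [|g x|]; being positive, it excludes the empty sum. *)
have [n] := gx (C + Num.truncn `|g x|).+1.
case: n => [|n]; first by rewrite /birkhoff_sum big_ord0 ltNge ler0n.
rewrite birkhoff_sumS => Cn; exists n; have := truncnS_gt `|g x|.
have := ler_norm (g x); move: Cn; rewrite -!natr1 natrD; lra.
Qed.

(* On this forward-invariant set [E] both [(f - b) 1_E] and [(a - f) 1_E] satisfy the
   hypothesis of the maximal inequality, and their sum is [(a - b) 1_E]. *)
Lemma negligible_oscillation (f : T -> R) (B a b : R) : measurable_fun setT f ->
  (forall x, `|f x| <= B) -> a < b ->
  P.-negligible (divergent_sums (fun x => f x - b) `&`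
                 divergent_sums (fun x => a - f x)).
Proof.
move=> mf fB ab; set E := _ `&` _.
have mfb : measurable_fun setT (fun x => f x - b) by exact: measurable_funB.
have maf : measurable_fun setT (fun x => a - f x) by exact: measurable_funB.
have mE : measurable E by apply: measurableI; exact: measurable_divergent_sums.
have m1 : measurable_fun setT (\1_E : T -> R) by exact: measurable_indic.
have EU x j : E x -> E (iter j U x).
  by move=> [E1 E2]; split; exact: divergent_sums_iter.
have int_ge0 (g : T -> R) (M : R) : measurable_fun setT g ->
    (forall x, `|g x| <= M) -> E `<=` divergent_sums g ->
    0 <= \int[P]_x (g x * \1_E x).
  move=> mg gM Eg; apply: (@maximal_ergodic _ M).
  - exact: measurable_funM.
  - move=> x; apply: le_trans (gM x); rewrite indicE.
    by case: (_ \in _); rewrite ?mulr1 ?mulr0 ?normr0.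
  (* The exceptional set is empty: a negative value of [g * \1_E] occurs only on [E], where by
     forward invariance the sums are those of [g] and one of them is positive. *)
  rewrite (_ : [set x | _] = set0); first exact: negligible_set0.
  apply/seteqP; split => // x [gx Sx].
  have xE : E x.
    apply: contrapT => nE; move: gx.
    by rewrite indicE memNset// mulr0 ltxx.
  have [n] := Eg _ xE 0%N; have := Sx n; rewrite /birkhoff_sum.
  rewrite (eq_bigr (fun j : 'I_n => g (iter j U x))); last first.
    by move=> j _; rewrite indicE mem_set ?mulr1//; exact: EU.
  by move=> Sn S0; have := lt_le_trans S0 Sn; rewrite ltxx.
have bnd (c : R) x : `|f x - c| <= B + `|c|.
  by apply: le_trans (ler_normB _ _) _; rewrite lerD2r.
have Ib := int_ge0 _ _ mfb (bnd b) (@subIsetl _ _ _).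
have bnda x : `|a - f x| <= B + `|a| by rewrite distrC.
have Ia := int_ge0 _ _ maf bnda (@subIsetr _ _ _).
have bnd1 (g : T -> R) (M : R) : measurable_fun setT g ->
    (forall x, `|g x| <= M) -> P.-integrable setT (EFin \o (fun x => g x * \1_E x)).
  move=> mg gM; apply: (@bounded_integrable _ _ _ P _ M); first exact: measurable_funM.
  move=> x; apply: le_trans (gM x); rewrite indicE.
  by case: (_ \in _); rewrite ?mulr1 ?mulr0 ?normr0.
have := addr_ge0 Ia Ib; rewrite -RintegralD//; last 2 first.
- exact: bnd1 maf bnda.
- exact: bnd1 mfb (bnd b).
under eq_Rintegral do rewrite -mulrDl addrA subrK.
rewrite RintegralZl//; last first.
  apply: (@bounded_integrable _ _ _ P _ 1) => // x.
  by rewrite indicE; case: (_ \in _); rewrite ?normr0 ?normr1.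
rewrite nmulr_rge0 ?subr_lt0// /Rintegral integral_indic// setIT => PE0.
apply/(negligibleP P mE)/eqP; rewrite eq_le measure_ge0 andbT.
have Pfin : P E \is a fin_num.
  rewrite ge0_fin_numE//; apply: le_lt_trans (probability_le1 P mE) _.
  by rewrite ltry.
by rewrite -[leLHS]fineK ?lee_fin.
Qed.

(** By [cvg_average], a point without a limit has sums oscillating across some rational interval,
    and each of these countably many sets is negligible. *)
Theorem birkhoff_ergodic (f : T -> R) (B : R) : measurable_fun setT f ->
  (forall x, `|f x| <= B) ->
  P.-negligible [set x | ~ cvgn (fun k => k%:R^-1 * birkhoff_sum f k x)].
Proof.
move=> mf fB.
pose E (q : rat * rat) := if q.1 < q.2 then
  divergent_sums (fun x => f x - ratr q.2) `&` divergent_sums (fun x => ratr q.1 - f x)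
  else set0.
have nE q : P.-negligible (E q).
  rewrite /E; case: ifPn => [q12|_]; last exact: negligible_set0.
  by apply: negligible_oscillation mf fB _; rewrite ltr_rat.
have : P.-negligible (\bigcup_n (if unpickle n is Some q then E q else set0)).
  apply: negligible_bigcup => n; case: unpickle => [q|]; first exact: nE.
  exact: negligible_set0.
apply: negligibleS => x; apply: contra_notP => nE'.
have {}nE' (q : rat * rat) : ~ E q x.
  by move=> Eqx; apply: nE'; exists (pickle q); [exact: I|rewrite pickleK].
have sumB (c : R) n :
    birkhoff_sum (fun x => f x - c) n x = birkhoff_sum f n x - c * n%:R.
  by rewrite /birkhoff_sum sumrB sumr_const card_ord mulr_natr.
have sumBN (c : R) n :
    birkhoff_sum (fun x => c - f x) n x = c * n%:R - birkhoff_sum f n x.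
  by rewrite /birkhoff_sum sumrB sumr_const card_ord mulr_natr.
apply: (@cvg_average _ _ B) => [n|a b ab].
  apply: le_trans (ler_norm_sum _ _ _) _; rewrite mulrC mulr_natr.
  by apply: le_trans (ler_sum _ (fun i _ => fB _)) _; rewrite sumr_const card_ord.
have bounded (g : T -> R) : ~ divergent_sums g x ->
    exists C : R, forall n, birkhoff_sum g n x <= C.
  move=> /existsNP[C /forallNP gC]; exists C%:R => n.
  by rewrite leNgt; apply/negP; exact: gC.
have := nE' (a, b); rewrite /E/= ab => /not_andP[] /bounded[C gC].
  by left; exists C => n; rewrite -sumB.
by right; exists C => n; rewrite -sumBN.
Qed.

End birkhoff.

(** * Lifting invariant measures *)

(** Stated as a predicate closed under linear combinations, so that continuous functions inherit the
    [lmodType] structure to which [hahn_banach] applies. *)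
Definition continuous_pred (R : realType) (Z : topologicalType) : {pred Z -> R} :=
  fun f => `[< continuous f >].

Lemma continuous_submod_closed (R : realType) (Z : topologicalType) :
  submod_closed (@continuous_pred R Z).
Proof.
split; first by apply/asboolP; exact: cst_continuous.
move=> c f g /asboolP cf /asboolP cg; apply/asboolP => x.
by apply: cvgD; [apply: cvgZr; exact: cf|exact: cg].
Qed.

HB.instance Definition _ (R : realType) (Z : topologicalType) :=
  GRing.isSubmodClosed.Build _ _ (@continuous_pred R Z)
    (@continuous_submod_closed R Z).

Record contfun (R : realType) (Z : topologicalType) :=
  Contfun { contfun_fun : Z -> R ; contfunP : contfun_fun \in @continuous_pred R Z }.

HB.instance Definition _ (R : realType) (Z : topologicalType) :=
  [isSub for @contfun_fun R Z].
HB.instance Definition _ (R : realType) (Z : topologicalType) :=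
  [Choice of contfun R Z by <:].
HB.instance Definition _ (R : realType) (Z : topologicalType) :=
  [SubChoice_isSubLmodule of contfun R Z by <:].

Lemma contfun_continuous (R : realType) (Z : topologicalType) (f : contfun R Z) :
  continuous (contfun_fun f).
Proof. exact/asboolP/(contfunP f). Qed.

Lemma contfunD (R : realType) (Z : topologicalType) (f g : contfun R Z) z :
  contfun_fun (f + g) z = contfun_fun f z + contfun_fun g z.
Proof. by []. Qed.

Lemma contfunZ (R : realType) (Z : topologicalType) c (f : contfun R Z) z :
  contfun_fun (c *: f) z = c * contfun_fun f z.
Proof. by []. Qed.

Section factor.
Context (R : realType) (Z Y : pseudoPMetricType R) (U : Z -> Z) (S : Y -> Y)
  (pi : Z -> Y).

Definition fibre_sup (h : Z -> R) (y : Y) : R := sup [set h z | z in pi @^-1` [set y]].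

Hypothesis cZ : compact [set: Z].
Hypothesis pi_surj : forall y, exists z, pi z = y.

Let has_sup_fibre (h : Z -> R) y : continuous h ->
  has_sup [set h z | z in pi @^-1` [set y]].
Proof.
move=> ch; split.
  by have [z zy] := pi_surj y; exists (h z), z.
have [M hM] := continuous_bounded cZ ch; exists M => _ [z _ <-].
exact: le_trans (ler_norm _) (hM z).
Qed.

Lemma fibre_sup_ge h z : continuous h -> h z <= fibre_sup h (pi z).
Proof. by move=> ch; apply: (ub_le_sup (proj2 (has_sup_fibre _ ch))); exists z. Qed.

Lemma fibre_sup_le h y c : continuous h -> (forall z, pi z = y -> h z <= c) ->
  fibre_sup h y <= c.
Proof.
move=> ch hc; apply: ge_sup; first exact: (proj1 (has_sup_fibre _ ch)).
by move=> _ [z zy <-]; exact: hc.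
Qed.

Lemma fibre_sup_bounded h M : continuous h -> (forall z, `|h z| <= M) ->
  forall y, `|fibre_sup h y| <= M.
Proof.
move=> ch hM y; rewrite ler_norml; apply/andP; split; last first.
  by apply: fibre_sup_le => // z _; exact: le_trans (ler_norm _) (hM z).
have [z <-] := pi_surj y; apply: le_trans (fibre_sup_ge z ch).
by have := hM z; rewrite ler_norml => /andP[].
Qed.

Hypothesis pi_open : forall A, open A -> open (pi @` A).

(** The set where the fibre supremum exceeds [c] is the image under [pi] of the open set where
    [h > c], hence open. *)
Lemma measurable_fibre_sup h : continuous h ->
  measurable_fun [set: Borel Y] (fibre_sup h : Borel Y -> R).
Proof.
move=> ch; apply: (measurability _ (RGenOInfty.measurableE R)).
move=> _ [_ [c ->] <-]; rewrite setTI; apply: open_Borel.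
have -> : fibre_sup h @^-1` `]c, +oo[ = pi @` (h @^-1` [set x | c < x]).
  apply/seteqP; split => y /=; rewrite in_itv/= andbT; last first.
    by move=> [z hz <-]; exact: lt_le_trans hz (fibre_sup_ge z ch).
  move=> /(sup_gt (proj1 (has_sup_fibre y ch)))[_ [z zy <-] cz].
  by exists z.
by apply: pi_open; have /continuousP := ch; apply; exact: open_gt.
Qed.

Hypothesis cU : continuous U.
Hypothesis cS : continuous S.
Hypothesis cpi : continuous pi.
Hypothesis piU : forall z, S (pi z) = pi (U z).
Variable nu : probability (Borel Y) R.
Hypothesis nuS : inv_measures S nu.

Let p0 (h : Z -> R) : R := \int[nu]_y fibre_sup h y.

Let int_fibre (h : Z -> R) : continuous h ->
  nu.-integrable setT (EFin \o (fibre_sup h : Borel Y -> R)).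
Proof.
move=> ch; have [M hM] := continuous_bounded cZ ch.
apply: (@bounded_integrable _ (Borel Y) R nu _ M); first exact: measurable_fibre_sup.
exact: fibre_sup_bounded.
Qed.

Let contD (f g : Z -> R) : continuous f -> continuous g ->
  continuous (fun z => f z + g z).
Proof. by move=> cf cg z; apply: cvgD; [exact: cf|exact: cg]. Qed.

Let contN (f : Z -> R) : continuous f -> continuous (fun z => - f z).
Proof. by move=> cf z; apply: cvgN; exact: cf. Qed.

Let contU (f : Z -> R) : continuous f -> continuous (fun z => f (U z)).
Proof. by move=> cf z; apply: (@continuous_comp _ _ _ U f); [exact: cU|exact: cf]. Qed.

Let int_cst (c : R) : \int[nu]_y c = c.
Proof.
have nuT : fine (nu setT) = 1 by rewrite probability_setT.
by rewrite -[RHS]mulr1 -nuT; exact: Rintegral_cst.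
Qed.

Let p0D (f g : Z -> R) : continuous f -> continuous g ->
  p0 (fun z => f z + g z) <= p0 f + p0 g.
Proof.
move=> cf cg; rewrite /p0 -RintegralD//; [|exact: int_fibre|exact: int_fibre].
apply: le_Rintegral => //; first exact/int_fibre/contD.
  exact: (integrableD measurableT (int_fibre cf) (int_fibre cg)).
move=> y _; apply: fibre_sup_le => [|z <-]; first exact: contD.
by rewrite lerD// fibre_sup_ge.
Qed.

Let p0_le (f : Z -> R) (w : Y -> R) (M : R) : continuous f ->
  measurable_fun [set: Borel Y] (w : Borel Y -> R) -> (forall y, `|w y| <= M) ->
  (forall z, f z <= w (pi z)) -> p0 f <= \int[nu]_y w y.
Proof.
move=> cf mw wM fw; apply: le_Rintegral => //; first exact: int_fibre.
  exact: (@bounded_integrable _ (Borel Y) R nu w M).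
by move=> y _; apply: fibre_sup_le => // z <-.
Qed.

Let p0_cst (f : Z -> R) (c : R) : continuous f -> (forall z, f z <= c) -> p0 f <= c.
Proof.
move=> cf fc; rewrite -[leRHS]int_cst.
exact: (@p0_le f (fun=> c) `|c|).
Qed.

Let p0Z (f : Z -> R) (c : R) : continuous f -> 0 < c ->
  p0 (fun z => c * f z) <= c * p0 f.
Proof.
move=> cf c0; have ccf : continuous (fun z => c * f z).
  by move=> z; apply: cvgM; [exact: cvg_cst|exact: cf].
rewrite /p0 -RintegralZl//; last exact: int_fibre.
apply: le_Rintegral => //; first exact: int_fibre.
  exact: (integrableZl measurableT c (int_fibre cf)).
move=> y _; apply: fibre_sup_le => // z <-.
by rewrite ler_pM2l// fibre_sup_ge.
Qed.

(** [U] maps the fibre over [y] into the fibre over [S y], so the supremum of [f o U] over the first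
    is at most that of [f] over the second; [nu] is [S]-invariant. *)
Let p0U (f : Z -> R) : continuous f -> p0 (fun z => f (U z)) <= p0 f.
Proof.
move=> cf; have [M fM] := continuous_bounded cZ cf.
have mS : measurable_fun [set: Borel Y] (S : Borel Y -> Borel Y).
  exact: continuous_Borel.
have -> : p0 f = \int[nu]_y fibre_sup f (S y).
  apply/esym; apply: (@Rintegral_pushforward _ _ (Borel Y) (Borel Y) R nu nu S _ M mS nuS).
    exact: measurable_fibre_sup.
  exact: fibre_sup_bounded.
apply: (@p0_le _ _ M); first exact: contU.
- exact: (measurableT_comp (measurable_fibre_sup cf) mS).
- by move=> y; exact: fibre_sup_bounded.
- by move=> z; rewrite piU fibre_sup_ge.
Qed.

Let p (h : contfun R Z) : R := inf [set p0 (fun z => contfun_fun h z +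
  (contfun_fun g z - contfun_fun g (U z))) | g in [set: contfun R Z]].

Let contcob (h g : contfun R Z) : continuous (fun z => contfun_fun h z +
  (contfun_fun g z - contfun_fun g (U z))).
Proof.
by apply: contD; [|apply: contD; [|apply/contN/contU]]; exact: contfun_continuous.
Qed.

Let p_sublinear : sublinear p /\ forall g h : contfun R Z,
  p h <= p0 (fun z => contfun_fun h z + (contfun_fun g z - contfun_fun g (U z))).
Proof.
have cc := @contfun_continuous R Z.
have [||||||sp ple] := @sublinear_inf R (contfun R Z) (contfun R Z) setT
  (fun g h => p0 (fun z => contfun_fun h z + (contfun_fun g z - contfun_fun g (U z))))
  (fun h => - p0 (fun z => - contfun_fun h z)).
- by exists 0.
- move=> g h _; rewrite lerNl.
  set k := fun z => contfun_fun h z + _.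
  have ck : continuous k by exact: contcob.
  (* Finiteness of the infimum: since [g = g o U + (k - h)], subadditivity and [p0U] give
     [0 <= p0 (k - h) <= p0 k + p0 (- h)]. *)
  have h1 : p0 (contfun_fun g) <=
      p0 (fun z => contfun_fun g (U z)) + p0 (fun z => k z - contfun_fun h z).
    rewrite [X in p0 X <= _](_ : _ =
        (fun z => contfun_fun g (U z) + (k z - contfun_fun h z))).
      by apply: p0D; [exact: contU|apply: contD => //; exact: contN].
    by apply/funext => z; rewrite /k; ring.
  have h2 := p0U (cc g).
  have h3 : p0 (fun z => k z - contfun_fun h z) <= p0 k + p0 (fun z => - contfun_fun h z).
    by apply: p0D => //; exact: contN.
  move: h1 h2 h3; lra.
- rewrite oppr_ge0; apply: p0_cst => [|z]; first exact/contN/cc.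
  by rewrite oppr0.
- exists 0 => //; apply: p0_cst => [|z]; first exact: contcob.
  by rewrite subrr addr0.
- move=> g g' h h' _ _; exists (g + g') => //.
  rewrite [X in p0 X <= _](_ : _ =
    (fun z => (contfun_fun h z + (contfun_fun g z - contfun_fun g (U z)))
    + (contfun_fun h' z + (contfun_fun g' z - contfun_fun g' (U z))))).
    by apply: p0D; exact: contcob.
  by apply/funext => z; rewrite !contfunD; ring.
- move=> g c h _ c0; exists (c *: g) => //.
  rewrite [X in p0 X <= _](_ : _ = (fun z =>
    c * (contfun_fun h z + (contfun_fun g z - contfun_fun g (U z))))).
    by apply: p0Z => //; exact: contcob.
  by apply/funext => z; rewrite !contfunZ; ring.
- by split=> // g h; exact: ple.
Qed.

(** The last clause encodes optimality of the lift: as [L] agrees with [p] at [- f], the integral of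
    [f] is [- p (- f)], so a [c] below it leaves room for a [g] nearly attaining the infimum that
    defines [p (- f)]. *)
Lemma exists_lift (f : Z -> R) : continuous f ->
  exists lam : probability (Borel Z) R,
    [/\ inv_measures U lam, pushforward_eq pi lam nu &
     forall c, c < \int[lam]_z f z -> exists g : Z -> R, continuous g /\
       \int[nu]_y fibre_sup (fun z => - f z + (g z - g (U z))) y < - c].
Proof.
move=> cf; have [sp ple] := p_sublinear.
have cc := @contfun_continuous R Z.
have cfunP (h : Z -> R) : continuous h -> exists k : contfun R Z, contfun_fun k = h.
  by move=> ch; exists (Contfun (asboolT ch)).
have [F FE] := cfunP _ cf.
have [L0 [L0D L0Z L0p L0F]] := hahn_banach (- F) sp.
(* [L0] is extended by the default [0] to all functions, the type expected by
   [riesz_representation]; only continuous arguments matter. *)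
have [L LE] : exists L : (Z -> R) -> R, forall h : contfun R Z, L (contfun_fun h) = L0 h.
  exists (fun h => if pselect (continuous h) is left ch
    then L0 (Contfun (asboolT ch)) else 0).
  move=> h; case: pselect => [ch|]; last by have := cc h.
  by congr L0; exact: val_inj.
have Lp0 (h g : Z -> R) : continuous h -> continuous g ->
    L h <= p0 (fun z => h z + (g z - g (U z))).
  move=> /cfunP[h' <-] /cfunP[g' <-]; rewrite LE.
  exact: le_trans (L0p _) (ple _ _).
have Lp (h : Z -> R) : continuous h -> L h <= p0 h.
  move=> ch; have := @Lp0 h (fun=> 0) ch (@cst_continuous _ _ _).
  by under eq_fun do rewrite subrr addr0.
have LD (h g : Z -> R) : continuous h -> continuous g ->
    L (fun z => h z + g z) = L h + L g.
  by move=> /cfunP[h' <-] /cfunP[g' <-]; rewrite !LE -L0D -LE.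
have LZ c (h : Z -> R) : continuous h -> L (fun z => c * h z) = c * L h.
  by move=> /cfunP[h' <-]; rewrite !LE -L0Z -LE.
have LN (h : Z -> R) : continuous h -> L (fun z => - h z) = - L h.
  move=> ch; rewrite -mulN1r -LZ//; congr L.
  by apply/funext => z; rewrite mulN1r.
have cst_c c : continuous ((fun=> c) : Z -> R) by exact: cst_continuous.
have Lge0 (h : Z -> R) : continuous h -> (forall z, 0 <= h z) -> 0 <= L h.
  move=> ch h0; rewrite -oppr_le0 -LN//; have cNh := contN ch.
  apply: le_trans (Lp _ cNh) _; apply: p0_cst => // z.
  by rewrite oppr_le0.
have L1 : L (fun=> 1) = 1.
  apply/eqP; rewrite eq_le; apply/andP; split.
    by apply: le_trans (Lp _ (cst_c 1)) _; apply: p0_cst.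
  rewrite -lerN2 -LN//; apply: le_trans (Lp _ _) _; first exact: cst_c.
  by apply: p0_cst => //; exact: cst_c.
have [lam lamE] := riesz_representation LD LZ Lge0 L1 cZ.
have lam_cov (h : Z -> R) : continuous h -> (forall z, 0 <= h z <= 1) ->
    (\int[lam]_z (h z)%:E = (L h)%:E)%E.
  move=> ch h01; rewrite -lamE// fineK//; apply: integrable_fin_num => //.
  apply: (@bounded_integrable _ (Borel Z) R lam h 1); first exact: continuous_Borel_real.
  by move=> z; have /andP[h0 h1] := h01 z; rewrite ger0_norm.
have lamfin : (lam setT < +oo)%E by rewrite probability_setT ltry.
exists lam; split.
- move=> A mA; have mUZ := continuous_Borel cU.
  apply/esym; apply: (@eq_measure_continuous R Z lam
    (pushforward lam (U : Borel Z -> Borel Z))) => // h ch h01.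
  rewrite ge0_integral_pushforward//; last 2 first.
    by apply/measurable_EFinP; exact: continuous_Borel_real.
    by move=> z _; rewrite lee_fin; case/andP: (h01 z).
  rewrite preimage_setT [RHS](lam_cov (fun z => h (U z)) (contU ch) (fun z => h01 (U z))).
  rewrite lam_cov//; congr EFin; apply/eqP; rewrite eq_le.
  (* Taking [g] itself in the infimum cancels [g o U - g], so [L (g o U - g) <= 0]; applying this to
     [h] and [- h] gives equality. *)
  have coboundary (g : Z -> R) : continuous g -> L (fun z => g (U z)) <= L g.
    move=> cg; rewrite -subr_le0 -LN// -LD; [|exact: contU|exact: contN].
    have ck : continuous (fun z => g (U z) + - g z).
      by apply: contD; [exact: contU|exact: contN].
    apply: le_trans (Lp0 _ g ck cg) _; apply: p0_cst => [|z].
      by apply: contD => //; apply: contD => //; apply: contN; exact: contU.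
    by rewrite addrC subrKA subrr.
  rewrite coboundary// andbT -lerN2 -(LN _ ch) -(LN _ (contU ch)).
  by apply: (coboundary (fun z => - h z)); exact: contN.
- move=> B mB; have mpi := continuous_Borel cpi.
  have nufin : (nu setT < +oo)%E by rewrite probability_setT ltry.
  apply/esym; apply: (@eq_measure_continuous R Y nu
    (pushforward lam (pi : Borel Z -> Borel Y))) => // w cw w01.
  have cwpi : continuous (fun z => w (pi z)).
    by move=> z; apply: (@continuous_comp _ _ _ pi w); [exact: cpi|exact: cw].
  have mw := continuous_Borel_real cw.
  have wb y : `|w y| <= 1 by have /andP[w0 w1] := w01 y; rewrite ger0_norm.
  have iw : nu.-integrable setT (EFin \o (w : Borel Y -> R)).
    exact: (@bounded_integrable _ (Borel Y) R nu w 1).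
  rewrite ge0_integral_pushforward//; last 2 first.
    exact/measurable_EFinP.
    by move=> y _; rewrite lee_fin; case/andP: (w01 y).
  rewrite preimage_setT [RHS](lam_cov (fun z => w (pi z)) cwpi (fun z => w01 (pi z))).
  rewrite -[LHS]fineK; last exact: integrable_fin_num.
  (* On each fibre [w o pi] is constant, so [p0] bounds [L (w o pi)] by the integral of [w]; the
     same for [- w] gives the reverse. *)
  congr EFin; apply/eqP; rewrite eq_le; apply/andP; split; last first.
    by apply: le_trans (Lp _ cwpi) _; apply: (@p0_le _ _ 1).
  rewrite -lerN2 -LN//.
  apply: le_trans (Lp _ (contN cwpi)) _.
  have -> : - fine (\int[nu]_x (w x)%:E) = \int[nu]_y (- 1 * w y).
    by rewrite RintegralZl// mulN1r.
  apply: (@p0_le _ _ 1); first exact: contN.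
  - by apply: measurable_funM.
  - by move=> y; rewrite mulN1r normrN.
  - by move=> z; rewrite mulN1r.
- move=> c; rewrite lamE// -FE LE -ltrN2 -[- L0 F]mulN1r -L0Z scaleN1r L0F => pc.
  have ne : [set p0 (fun z => contfun_fun (- F) z + (contfun_fun g z -
      contfun_fun g (U z))) | g in [set: contfun R Z]] !=set0.
    by eexists; exists 0.
  have [_ [g _ <-] gc] := inf_lt ne pc.
  by exists (contfun_fun g).
Qed.

End factor.

(** * The inequality *)

Lemma ereal_between (R : realType) (x : \bar R) (r : R) :
  (x < r%:E)%E -> exists2 c : R, (x < c%:E)%E & c < r.
Proof.
case: x => [s|//|_].
  by rewrite lte_fin => sr; exists ((s + r) / 2); rewrite ?lte_fin midf_lt.
by exists (r - 1); rewrite ?ltNyr// ltrBlDr ltrDl.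
Qed.

Lemma average_ge (R : realType) (s : nat -> R) (c K l : R) :
  (forall n, c * n%:R - K <= s n) -> n%:R^-1 * s n @[n --> \oo] --> l -> c <= l.
Proof.
move=> sc sl; rewrite leNgt; apply/negP => lc.
pose e := (c - l) / 2; have e0 : 0 < e by rewrite divr_gt0// subr_gt0.
have le : l < c - e.
  by rewrite /e; lra.
have /(cvgr_lt _)/(_ _ le)[N _ NP] := sl.
(* Beyond [N] the average is below [c - e], and beyond [K / e] the loss [K] is below [n * e];
   together they contradict [c * n - K <= s n]. *)
pose n := (maxn N (Num.truncn (K / e))).+1.
have n0 : 0 < n%:R :> R by rewrite ltr0n.
have := NP n; rewrite /= => /(_ _) sn.
have {}sn : s n < n%:R * (c - e).
  by rewrite -ltr_pdivrMl//; apply: sn; apply: leq_trans (leq_maxl _ _) (leqnSn _).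
have Kn : K < n%:R * e.
  rewrite -ltr_pdivrMr//; apply: lt_le_trans (truncnS_gt _) _.
  by rewrite ler_nat ltnS leq_maxr.
by have := sc n; move: sn; rewrite mulrBr [n%:R * c]mulrC; lra.
Qed.

Theorem theorem1p10 (R : realType) (Z Y : pseudoPMetricType R)
  (U : Z -> Z) (S : Y -> Y) (pi : Z -> Y) :
  TDS U -> TDS S ->
  continuous pi -> (forall y : Y, exists z : Z, pi z = y) ->
  (forall z : Z, S (pi z) = pi (U z)) ->
  (forall A : set Z, open A -> open (pi @` A)) ->
  forall f : Z -> R, continuous f ->
  (alpha U S pi f <= beta U pi f)%E.
Proof.
move=> [cZ _ [cU _]] [_ _ [cS _]] cpi pi_surj piU pi_open f cf.
apply: ge_ereal_sup => _ [nu nuS <-].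
have [lam [lamU lampi lamf]] := exists_lift cZ pi_surj pi_open cU cS cpi piU nuS cf.
have mf := continuous_Borel_real cf; have mU := continuous_Borel cU.
have [B fB] := continuous_bounded cZ cf.
have lam_bounded (h : Z -> R) M : measurable_fun [set: Borel Z] (h : Borel Z -> R) ->
    (forall z, `|h z| <= M) -> lam.-integrable setT (EFin \o (h : Borel Z -> R)).
  by move=> mh hM; exact: (@bounded_integrable _ (Borel Z) R lam h M).
apply: (@le_trans _ _ (\int[lam]_z f z)%:E).
  apply: ereal_inf_lbound; exists lam => //.
  by rewrite fineK//; apply: integrable_fin_num => //; exact: lam_bounded fB.
rewrite leNgt; apply/negP => /ereal_between[c betac /lamf[g [cg gc]]].
set k := (fun z => - f z + _) in gc.
have ck : continuous k.
  move=> z; apply: cvgD; first by apply: cvgN; exact: cf.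
  apply: cvgB; first exact: cg.
  by apply: (@continuous_comp _ _ _ U g); [exact: cU|exact: cg].
have [M gM] := continuous_bounded cZ cg.
have [K kK] := continuous_bounded cZ ck.
(* This [G] is minus the fibrewise minimum of [f - g + g o U], so its integral is below [- c] and
   the integral of [c + G o pi] must be negative. *)
pose G := fibre_sup pi k.
have mG : measurable_fun [set: Borel Y] (G : Borel Y -> R).
  exact: measurable_fibre_sup.
have GK : forall y, `|G y| <= K by exact: fibre_sup_bounded.
have mpi := continuous_Borel cpi.
have mGpi : measurable_fun [set: Borel Z] (fun z : Borel Z => G (pi z)).
  exact: (measurableT_comp mG mpi).
suff : 0 <= \int[lam]_z (c + G (pi z)).
  rewrite RintegralD//; last 2 first.
    by apply: (@lam_bounded (fun=> c) `|c|).
    exact: lam_bounded mGpi (fun z => GK (pi z)).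
  have -> : \int[lam]_z c = c.
    have lamT : fine (lam setT) = 1 by rewrite probability_setT.
    by rewrite -[RHS]mulr1 -lamT; exact: Rintegral_cst.
  rewrite (Rintegral_pushforward mpi lampi mG GK) -lerBlDl sub0r.
  by rewrite leNgt gc.
apply: (@maximal_ergodic _ (Borel Z) R lam U mU lamU _ (`|c| + K)).
- by apply: measurable_funD.
- by move=> z; apply: le_trans (ler_normD _ _) _; rewrite lerD2l.
(* It remains to refute a point [z] whose averages of [f] converge while all sums of [c + G o pi]
   are nonpositive. *)
apply: negligibleS (birkhoff_ergodic mU lamU mf fB) => z [_ Fz] zf.
have piiter (x : Z) j : pi (iter j U x) = iter j S (pi x).
  by elim: j => //= j IH; rewrite -piU IH.
have : (ereal_inf [set (limn (birkhoff_avg U f z))%:E |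
    z in Rf U f `&` pi @^-1` [set pi z]] < c%:E)%E.
  by apply: le_lt_trans betac; apply: ereal_sup_ubound; exists (pi z) => //; exists z.
move=> /ereal_inf_lt[_ [z' [zf' zz'] <-]]; rewrite lte_fin ltNge => /negP; apply.
(* The point [z'] shares the fibre of [z] and has limit below [c]; the contradiction is that its
   sums of [f] stay above [c * n - 2 M], where [2 M] bounds the telescoped coboundary of [g]. *)
apply: (@average_ge _ (fun n => \sum_(j < n) f (iter j U z')) c (M + M)) zf' => n.
have telescope : \sum_(j < n) (c + k (iter j U z')) =
    c * n%:R - \sum_(j < n) f (iter j U z') + (g z' - g (iter n U z')).
  elim: n => [|n IH]; first by rewrite !big_ord0/=; ring.
  by rewrite !big_ord_recr/= IH /k -natr1; ring.
have := Fz n; rewrite /birkhoff_sum.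
(* The orbits of [z] and [z'] lie over the same orbit of [S], so [G] along [z] dominates [k] along
   [z']. *)
have h : \sum_(j < n) (c + k (iter j U z')) <= \sum_(j < n) (c + G (pi (iter j U z))).
  apply: ler_sum => j _; rewrite lerD2l piiter -zz' -piiter.
  exact: fibre_sup_ge.
move=> /(le_trans h); rewrite telescope.
have := gM z'; have := gM (iter n U z'); rewrite !ler_norml.
move=> /andP[_ h1] /andP[h2 _]; lra.
Qed.
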